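(* Let $Z\subset\mathbb{R}^d$ be a coloopless $d$-dimensional lattice zonotope with at least $\ell^d$ lattice points, for some $\ell\in\mathbb{Z}_{>0}$. Then $\kappa(Z)\le\kappa^{\mathrm{LR}}_{d-1}+\frac1\ell$.
   Context: A lattice zonotope in $\mathbb{R}^d$ is (up to integer translation) $\sum_{\mathbf{u}\in U}[\mathbf{0},\mathbf{u}]$ for a finite $U\subset\mathbb{Z}^d$; it is centrally symmetric about its center $\mathbf{c}=\frac12\sum\mathbf{u}$. It is coloopless if it admits a generating set $U$ of rank $d$ with a linear dependence $\sum\lambda_{\mathbf{u}}\mathbf{u}=0$ having all $\lambda_{\mathbf{u}}\neq0$. For a lattice zonotope $Z$ with center $\mathbf{c}$, $\kappa(Z)$ (the first $\mathbf{c}$-minimum) is the minimum $\lambda\ge0$ such that $\mathbf{c}+\lambda(Z-\mathbf{c})$ contains a point of $\mathbb{Z}^d$. A lonely runner (LR) zonotope of dimension $k$ is a $k$-dimensional lattice zonotope with $k+1$ generators all of whose $k\times k$ minors (the volume vector) are nonzero. $\kappa^{\mathrm{LR}}_{k}$ denotes the maximum of $\kappa(Z)$ over all LR zonotopes $Z$ of dimension $k$.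
   Formalization: The dimension d is assumed to be at least 2: for d = 1 the claim fails with κ^LR_0 = 0, e.g. Z = [0,3] with generators 1, 2 has 4 lattice points (ℓ = 4) but κ(Z) = 1/3 > 1/4. *)

(* Defs.v *)
From mathcomp Require Import all_boot all_order all_algebra.
From mathcomp Require Import boolp classical_sets cardinality reals.
Set Implicit Arguments.
Unset Strict Implicit.
Unset Printing Implicit Defensive.
Import Order.TTheory GRing.Theory Num.Theory.
Local Open Scope classical_set_scope.
Local Open Scope ring_scope.

Definition real_mx (R : realType) (m n : nat) (A : 'M[int]_(m, n)) :
  'M[R]_(m, n) := map_mx intr A.

(* A presentation of a lattice zonotope: an integer translation vector and a
   finite set of generators, listed without repetition as the rows of a matrix.
   Several presentations may have the same underlying body. *)
Record lattice_zonotope (d : nat) := LatticeZonotope {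
  ngens : nat;
  base : 'rV[int]_d;
  gens : 'M[int]_(ngens, d);
  gens_inj : injective (fun i => row i gens) }.

Section Zonotopes.
Variables (R : realType) (d : nat).
Implicit Type Z : lattice_zonotope d.

(* With t : 'rV_n, t *m gens is the combination of the generators with
   coefficients t. *)
Definition body Z : set 'rV[R]_d :=
  [set x | exists t : 'rV[R]_(ngens Z),
     (forall i, 0 <= t 0 i <= 1) /\
     x = real_mx R (base Z) + t *m real_mx R (gens Z)].

Definition center Z : 'rV[R]_d :=
  real_mx R (base Z) + 2^-1 *: \sum_i row i (real_mx R (gens Z)).

Definition zdim Z : nat := \rank (real_mx R (gens Z)).

(* A property of the body only: some presentation has the dependence. *)
Definition coloopless Z : Prop :=
  exists Z' : lattice_zonotope d,
    [/\ body Z' = body Z, zdim Z' = d &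
        exists lam : 'rV[R]_(ngens Z'),
          (forall i, lam 0 i != 0) /\ lam *m real_mx R (gens Z') = 0].

Definition lattice_points Z : set 'rV[int]_d :=
  [set p | body Z (real_mx R p)].

(* The infimum is over a set containing 1, as base Z is a lattice point of the
   body, and it is attained, as the body is compact. *)
Definition kappa Z : R :=
  inf [set lam : R | 0 <= lam /\
    exists p : 'rV[int]_d, exists2 z, body Z z &
      real_mx R p = center Z + lam *: (z - center Z)].

End Zonotopes.

Definition LR_zonotope (k : nat) (Z : lattice_zonotope k) : Prop :=
  ngens Z = k.+1 /\
  forall f : 'I_k -> 'I_(ngens Z), injective f -> \det (rowsub f (gens Z)) != 0.

(* The supremum is over a nonempty set bounded by 1; it is the maximum whenever
   a maximum exists. *)
Definition kappaLR (R : realType) (k : nat) : R :=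
  sup [set kappa R Z | Z in [set Z : lattice_zonotope k | LR_zonotope Z]].

(* Main.v *)
Require Import Defs.
From mathcomp Require Import all_boot all_order all_algebra.
From mathcomp Require Import boolp classical_sets cardinality reals functions.
From mathcomp Require Import zify ring lra.
Set Implicit Arguments.
Unset Strict Implicit.
Unset Printing Implicit Defensive.
Import Order.TTheory GRing.Theory Num.Theory.
Local Open Scope classical_set_scope.
Local Open Scope ring_scope.

(* Replacing two generators u, u' by u + u' or u - u' shrinks the body and moves
   the center by a lattice vector at most. If there are more than k + 1
   generators in dimension k, some such merge keeps the rank and the absence of
   coloops: on the space of linear dependences the coefficients are nonzero
   functionals, and the merge is harmless unless the difference or the sum of
   two of them is parallel to a third, which fails for two functionals adjacent
   in their plane. Iterating, every coloopless zonotope of dimension k has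
   kappa at most kappaLR k.
   If two lattice points p, q of Z are congruent modulo l, project along p - q:
   a lattice point of the projection of c + lam (Z - c) lifts to a lattice point
   of c + (lam + 1/l) (Z - c), since Z - c contains (p - q)/2 and p - q is at
   least l times a primitive vector. Otherwise the l^d points represent every
   class modulo l exactly once. For l = 2 this is impossible, because a basis
   among the generators together with one further generator yields 2^d + 1
   lattice points. For l >= 3 a suitable class gives a lattice point s of Z such
   that c + (s - b)/l (l even, b the base point), respectively c + (s - c)/l
   (l odd), is a lattice point; as s - b lies in 2 (Z - c), this yields
   kappa Z <= 2/l <= 1/3 + 1/l <= kappaLR (d - 1) + 1/l. *)

(** * Pairs of vectors adjacent in their plane *)

Section AdjacentDirections.
Variables (F : realFieldType) (V : lmodType F).

Definition indep2 (a b : V) : Prop :=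
  forall s t : F, s *: a + t *: b = 0 -> s = 0 /\ t = 0.

Definition open_cone (n : nat) (x : 'I_n -> V) (a b : V) : {set 'I_n} :=
  [set m | `[< exists s t : F, 0 < s * t /\ x m = s *: a + t *: b >]].

(* A pair spanning a double cone with as few of the vectors as possible inside
   it has none inside, hence none parallel to the sum of the pair. *)
Lemma adjacent_directions (n : nat) (x : 'I_n -> V) (i0 j0 : 'I_n) :
  (forall m, x m != 0) -> indep2 (x i0) (x j0) ->
  exists (i j : 'I_n) (e : bool), indep2 (x i) (x j) /\
    forall m c, x m != c *: (x i + (-1) ^+ e *: x j).
Proof.
move=> xn0 ind0.
suff H N : forall (i j : 'I_n) (e : bool), indep2 (x i) (x j) ->
    (#|open_cone x (x i) ((-1) ^+ e *: x j)| <= N)%N ->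
    exists (i j : 'I_n) (e : bool), indep2 (x i) (x j) /\
      forall m c, x m != c *: (x i + (-1) ^+ e *: x j).
  exact: (H _ i0 j0 false ind0 (leqnn _)).
elim: N => [|N IH] i j e ind card_le.
all: case: (pselect (exists m c, x m = c *: (x i + (-1) ^+ e *: x j))) => [[m [c xm]]|none];
  last by exists i, j, e; split=> // m c; apply/eqP=> xm; apply: none; exists m, c.
all: have c0 : c != 0 by apply: contraNneq (xn0 m) => c0; rewrite xm c0 scale0r.
all: have m_in : m \in open_cone x (x i) ((-1) ^+ e *: x j)
  by rewrite inE; apply/asboolP; exists c, c; split;
    [rewrite -expr2 exprn_even_gt0 | rewrite xm scalerDr].
  by move: card_le; rewrite leqn0 cards_eq0 => /eqP E; rewrite E inE in m_in.
have ind' : indep2 (x i) (x m).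
  move=> s t; rewrite xm scalerDr scalerDr !scalerA addrA -scalerDl => /ind [].
  move=> st tc; have /eqP : t = 0.
    by apply/eqP; move/eqP: tc; rewrite !mulf_eq0 signr_eq0 (negbTE c0) !orbF.
  by move=> /eqP t0; move: st; rewrite t0 mul0r addr0.
(* With this sign [(-1) ^+ e' *: x m] is a positive multiple of the sum, so the new double cone lies
   in the old one and no longer contains [x m]. *)
pose e' := c < 0.
apply: (IH i m e' ind').
rewrite -ltnS; apply: leq_trans card_le; apply: proper_card; apply/properP; split.
  apply/fintype.subsetP => l; rewrite !inE => -[s [t [st xl]]].
  exists (s + t * `|c|), (t * `|c|); split.
    have nc : 0 < `|c| by rewrite normr_gt0.
    have -> : (s + t * `|c|) * (t * `|c|) = (s * t) * `|c| + (t * `|c|) ^+ 2 by ring.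
    by rewrite ltr_wpDr ?sqr_ge0 // mulr_gt0.
  have ec : (-1) ^+ e' * c = `|c|.
    rewrite /e'; have [h|h] := ltrP c 0; first by rewrite mulN1r ltr0_norm.
    by rewrite mul1r ger0_norm.
  by rewrite xl xm !scalerDr !scalerA addrA -scalerDl -!mulrA !(mulrA _ c) ec.
exists m => //; rewrite inE; apply/negP => /asboolW [s [t [st E]]].
have [] := ind' s (t * (-1) ^+ e' - 1).
  by rewrite scalerBl scale1r addrA -scalerA -E subrr.
by move=> s0; move: st; rewrite s0 mul0r ltxx.
Qed.

End AdjacentDirections.

(** * Merging two generators without losing rank or creating coloops *)

Section Merging.

(** Row-wise form of a dependence with all coefficients nonzero: over an infinite field the two
    agree, and after a merge it is easier to find a dependence for each row separately. *)
Definition coloop_free (F : fieldType) (n k : nat) (A : 'M[F]_(n, k)) : Prop :=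
  forall i, exists2 x : 'rV[F]_n, x *m A = 0 & x 0 i != 0.

(** Multiplying generators by it on the left deletes row [j] and adds [(-1) ^+ e] times that row to
    row [lift j i]. *)
Definition merge_mx (F : pzRingType) (n : nat) (j : 'I_n.+1) (i : 'I_n) (e : bool) :
  'M[F]_(n, n.+1) := row' j 1%:M + (-1) ^+ e *: delta_mx i j.

Lemma map_merge_mx (F G : pzRingType) (f : {rmorphism F -> G}) (n : nat)
    (j : 'I_n.+1) (i : 'I_n) (e : bool) :
  map_mx f (merge_mx F j i e) = merge_mx G j i e.
Proof.
apply/matrixP=> a b; rewrite !mxE rmorphD rmorphM rmorphXn rmorphN1.
by rewrite !rmorph_nat.
Qed.

Lemma mul_merge_mx_lift (F : pzRingType) (n : nat) (j : 'I_n.+1) (i : 'I_n)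
    (e : bool) (x : 'rV[F]_n) (m : 'I_n) :
  (x *m merge_mx F j i e) 0 (lift j m) = x 0 m.
Proof.
rewrite mxE (bigD1 m) //= big1 ?addr0.
  by rewrite !mxE eqxx [_ == j]eq_sym (negbTE (neq_lift _ _)) andbF mulr0 addr0 mulr1.
move=> l lm; rewrite !mxE [lift j m == j]eq_sym (negbTE (neq_lift _ _)) andbF mulr0 addr0.
by rewrite (inj_eq lift_inj) (negbTE lm) mulr0.
Qed.

Lemma mul_merge_mx_pivot (F : comPzRingType) (n : nat) (j : 'I_n.+1) (i : 'I_n)
    (e : bool) (x : 'rV[F]_n) :
  (x *m merge_mx F j i e) 0 j = (-1) ^+ e * x 0 i.
Proof.
rewrite mxE (bigD1 i) //= big1 ?addr0.
  rewrite !mxE !eqxx [lift j i == j]eq_sym (negbTE (neq_lift _ _)) add0r mulr1.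
  by rewrite mulrC.
move=> l li; rewrite !mxE [lift j l == j]eq_sym (negbTE (neq_lift _ _)).
by rewrite (negbTE li) mulr0 addr0 mulr0.
Qed.

Lemma merge_mx_surj (F : comPzRingType) (n : nat) (j : 'I_n.+1) (i : 'I_n)
    (e : bool) (x : 'rV[F]_n.+1) :
  x 0 j = (-1) ^+ e * x 0 (lift j i) -> col' j x *m merge_mx F j i e = x.
Proof.
move=> xj; apply/rowP => l; case: (unliftP j l) => [m ->|->].
  by rewrite mul_merge_mx_lift mxE.
by rewrite mul_merge_mx_pivot mxE xj.
Qed.

Lemma col_mulmx (F : pzRingType) (m n p : nat) (j : 'I_p) (A : 'M[F]_(m, n))
    (B : 'M[F]_(n, p)) :
  col j (A *m B) = A *m col j B.
Proof. by rewrite !colE mulmxA. Qed.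

(** The cokernel of [y^T] detects membership in the line of [y], so one of its columns, which all
    annihilate [y], does not annihilate [x]. *)
Lemma separate_vectors (F : fieldType) (n : nat) (x y : 'cV[F]_n) :
  (forall c, x != c *: y) -> exists2 u : 'rV[F]_n, u *m y = 0 & u *m x != 0.
Proof.
move=> xy; have : ~~ (x^T <= y^T)%MS.
  apply/negP => /sub_rVP [c E]; have /eqP := xy c; apply.
  by apply: (can_inj (@trmxK _ _ _)); rewrite E linearZ.
rewrite submxE => nz.
have [l hl] : exists l, col l (x^T *m cokermx y^T) != 0.
  apply: contrapT => /forallNP h; move/negP: nz; apply; apply/eqP/matrixP => a b.
  by have /negP := h b; rewrite negbK => /eqP /matrixP /(_ a 0); rewrite !mxE.
exists (col l (cokermx y^T))^T.
  apply: (can_inj (@trmxK _ _ _)).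
  by rewrite trmx_mul trmxK -col_mulmx mulmx_coker linear0 trmx0.
apply: contra hl => /eqP h; apply/eqP; apply: (can_inj (@trmxK _ _ _)).
by rewrite col_mulmx trmx_mul trmxK h trmx0.
Qed.

(** Column [i] of [kermx A] is the [i]-th coefficient, viewed as a functional on dependences. Those
    descending to the merged generators form the zero set of one functional [y]; by adjacency no
    remaining coefficient is a multiple of [y], so none vanishes on all of them. *)
Lemma exists_merge (F : realFieldType) (n k : nat) (A : 'M[F]_(n.+1, k)) :
  (k < n)%N -> \rank A = k -> coloop_free A ->
  exists (j : 'I_n.+1) (i : 'I_n) (e : bool),
    \rank (merge_mx F j i e *m A) = k /\ coloop_free (merge_mx F j i e *m A).
Proof.
move=> kn rk free.
pose x (i : 'I_n.+1) : 'cV[F]_n.+1 := col i (kermx A).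
have kerE (u : 'rV[F]_n.+1) l : (u *m kermx A) 0 l = (u *m x l) 0 0.
  by rewrite /x -col_mulmx [RHS]mxE.
have xn0 m : x m != 0.
  have [u uA um] := free m; apply: contraNneq um => xm.
  have /submxP [v ->] : (u <= kermx A)%MS by apply/sub_kermxP.
  by rewrite kerE xm mulmx0 mxE.
(* If all columns were multiples of the first, the kernel would have rank at most 1, whereas its
   rank [n.+1 - k] is at least 2. *)
have [j0 ind0] : exists j0, indep2 (x ord0) (x j0).
  apply: contrapT => /forallNP nind.
  have par m : exists c, x m = c *: x ord0.
    apply: contrapT => npar; apply: (nind m) => s t E.
    have t0 : t = 0.
      apply/eqP; apply: contrapT => /negP t0; apply: npar; exists (- (s / t)).
      apply: (scalerI t0); rewrite scalerA mulrN mulrCA divff // mulr1 scaleNr.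
      by apply/eqP; rewrite -addr_eq0 addrC E.
    split=> //; move/eqP: E; rewrite t0 scale0r addr0 scaler_eq0 (negbTE (xn0 _)) orbF.
    by move/eqP.
  have [c hc] := boolp.choice par.
  have E : kermx A = x ord0 *m \row_m c m.
    apply/matrixP => a b; rewrite [RHS]mxE big_ord1 [(\row_m c m) _ _]mxE.
    by have /matrixP /(_ a 0) := hc b; rewrite /x !mxE mulrC.
  have := mulmx_max_rank (x ord0) (\row_m c m); rewrite -E mxrank_ker rk.
  by rewrite leqNgt ltn_subRL addn1 ltnS kn.
have [j [i [e [ind good]]]] := adjacent_directions xn0 ind0.
have ij : j != i.
  apply/eqP => E; rewrite E in ind.
  have /ind [/eqP] : 1 *: x i + (-1) *: x i = 0 by rewrite scale1r scaleN1r subrr.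
  by rewrite oner_eq0.
have [i' hi _] := unlift_some ij.
pose e' := ~~ e.
have eN : (-1) ^+ e' = - (-1) ^+ e :> F by rewrite /e' signrN.
pose y := x j + (-1) ^+ e *: x i.
have yE (u : 'rV[F]_n.+1) : (u *m y) 0 0 =
    (u *m kermx A) 0 j - (-1) ^+ e' * (u *m kermx A) 0 i.
  by rewrite eN !kerE mulmxDr -scalemxAr !mxE mulNr opprK.
exists j, i', e'; split; last first.
  move=> m; have [u uy ux] := separate_vectors (good (lift j m)).
  have uj : (u *m kermx A) 0 j = (-1) ^+ e' * (u *m kermx A) 0 (lift j i').
    by apply/eqP; rewrite -hi -subr_eq0 -yE /y uy mxE.
  exists (col' j (u *m kermx A)).
    by rewrite mulmxA merge_mx_surj // -mulmxA mulmx_ker mulmx0.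
  rewrite mxE kerE; apply: contra ux => /eqP h; apply/eqP/matrixP => a b.
  by rewrite !ord1 h mxE.
have [u uy] : exists u : 'rV[F]_n.+1,
    (u *m kermx A) 0 j - (-1) ^+ e' * (u *m kermx A) 0 i != 0.
  have y0 : y != 0.
    apply/eqP => y0; have /ind [/eqP] : 1 *: x j + (-1) ^+ e *: x i = 0.
      by rewrite scale1r.
    by rewrite oner_eq0.
  have [u _ uy] : exists2 u : 'rV[F]_n.+1, u *m (0 : 'cV_n.+1) = 0 & u *m y != 0.
    by apply: separate_vectors => c; rewrite scaler0.
  exists u; rewrite -yE; apply: contra uy => /eqP h; apply/eqP/matrixP => a b.
  by rewrite !ord1 h mxE.
set M := merge_mx _ _ _ _.
have /row_fullP [B BA] : row_full A by rewrite /row_full rk.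
suff : row_full (M *m A) by rewrite /row_full => /eqP.
rewrite -cokermx_eq0; set C := cokermx _.
(* Since [M *m D = 0], every row of [D] is zero or row [j] up to sign; the dependence
   [u *m kermx A], which does not descend, then forces row [j] to vanish. *)
pose D := A *m C.
have MD : M *m D = 0 by rewrite /D mulmxA mulmx_coker.
suff D0 : D = 0 by rewrite -[C]mul1mx -BA -mulmxA -/D D0 mulmx0.
have rowM m : row (lift j m) D + ((-1) ^+ e' * (m == i')%:R) *: row j D = 0.
  have := congr1 (row m) MD; rewrite row0 => <-.
  rewrite [RHS]row_mul /M /merge_mx linearD linearZ /= mulmxDl.
  rewrite row'Esub row_rowsub -row_mul mul1mx; congr (_ + _).
  rewrite -scalemxAl -scalerA; congr (_ *: _).
  apply/rowP => c; rewrite [RHS]mxE (bigD1 j) //= big1 ?addr0.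
    by rewrite !mxE eqxx andbT.
  by move=> l lj; rewrite !mxE (negbTE lj) andbF mul0r.
pose v := u *m kermx A.
have vD : v *m D = 0 by rewrite /D mulmxA -(mulmxA u) mulmx_ker mulmx0 mul0mx.
have Dj : row j D = 0.
  have : \sum_l v 0 l *: row l D = 0 by rewrite -mulmx_sum_row.
  rewrite (bigD1_ord j) //=.
  have -> : \sum_(m < n) v 0 (lift j m) *: row (lift j m) D =
            - ((-1) ^+ e' * v 0 i) *: row j D.
    rewrite (eq_bigr (fun m => - (v 0 (lift j m) * ((-1) ^+ e' * (m == i')%:R)) *: row j D)).
      rewrite (bigD1 i') //= big1 ?addr0; last by move=> m /negbTE ->; rewrite !mulr0 oppr0 scale0r.
      by rewrite eqxx mulr1 -hi mulrC.
    move=> m _; have /eqP := rowM m; rewrite addr_eq0 => /eqP ->.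
    by rewrite scalerN scalerA scaleNr.
  by rewrite -scalerDl => /eqP; rewrite scaler_eq0 (negbTE uy) => /eqP.
apply/row_matrixP => l; rewrite row0; case: (unliftP j l) => [m ->|-> //].
by have := rowM m; rewrite Dj scaler0 addr0.
Qed.

End Merging.

(** * Lattice points in dilates of a zonotope about its center *)

Section LatticeHits.
Variable R : realType.

(* The condition says that the zonotope of the rows of U, scaled by lam about
   its center, contains the lattice point p; base points are integral and play
   no role. *)
Definition lattice_hit (n d : nat) (U : 'M[int]_(n, d)) (lam : R) : Prop :=
  exists (p : 'rV[int]_d) (t : 'rV[R]_n),
    (forall i, `|t 0 i - 2^-1| <= lam / 2) /\ real_mx R p = t *m real_mx R U.

Lemma real_mxD (m n : nat) (A B : 'M[int]_(m, n)) :
  real_mx R (A + B) = real_mx R A + real_mx R B.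
Proof. exact: map_mxD. Qed.

Lemma real_mxB (m n : nat) (A B : 'M[int]_(m, n)) :
  real_mx R (A - B) = real_mx R A - real_mx R B.
Proof. exact: map_mxB. Qed.

Lemma real_mxM (m n p : nat) (A : 'M[int]_(m, n)) (B : 'M[int]_(n, p)) :
  real_mx R (A *m B) = real_mx R A *m real_mx R B.
Proof. exact: map_mxM. Qed.

Lemma lattice_hit_mono (n d : nat) (U : 'M[int]_(n, d)) (lam mu : R) :
  lam <= mu -> lattice_hit U lam -> lattice_hit U mu.
Proof.
move=> le [p [t [ht E]]]; exists p, t; split=> // i.
by apply: le_trans (ht i) _; rewrite ler_pM2r // invr_gt0.
Qed.

Lemma lattice_hit_basis (n d : nat) (U : 'M[int]_(n, d)) (P : 'M[int]_d) (lam : R) :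
  P \in unitmx -> lattice_hit (U *m P) lam -> lattice_hit U lam.
Proof.
move=> uP [p [t [ht E]]]; exists (p *m invmx P), t; split=> //.
rewrite /real_mx in E *; rewrite map_mxM E map_mxM mulmxA -[RHS]mulmx1.
rewrite -!mulmxA -map_mxM mulmxV //.
by rewrite map_mx1.
Qed.

(** For a sum, both generators receive the coefficient [t 0 i]. For a difference, row [j] receives
    [1 - t 0 i], equally far from 1/2, and the lattice point moves by [row j U]. *)
Lemma lattice_hit_merge (n d : nat) (U : 'M[int]_(n.+1, d)) (j : 'I_n.+1)
    (i : 'I_n) (e : bool) (lam : R) :
  lattice_hit (merge_mx int j i e *m U) lam -> lattice_hit U lam.
Proof.
move=> [p [t [ht E]]].
exists (p + e%:R *: row j U), (t *m merge_mx R j i e + e%:R *: delta_mx 0 j); split.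
  move=> l; case: (unliftP j l) => [m ->|->].
    rewrite mxE mul_merge_mx_lift !mxE [lift j m == j]eq_sym (negbTE (neq_lift _ _)) andbF.
    by rewrite mulr0 addr0.
  rewrite mxE mul_merge_mx_pivot !mxE !eqxx mulr1; apply: le_trans (ht i).
  case: e {E} => /=; last by rewrite mul1r addr0.
  by rewrite expr1 -[leRHS]normrN le_eqVlt; apply/orP; left; apply/eqP; congr `|_|; lra.
rewrite /real_mx in E *.
rewrite map_mxD map_mxZ map_row mulmxDl E map_mxM map_merge_mx mulmxA; congr (_ + _).
by rewrite -scalemxAl -rowE; case: (e).
Qed.

Lemma half_gens (n d : nat) (A : 'M[R]_(n, d)) :
  2^-1 *: \sum_i row i A = const_mx 2^-1 *m A.
Proof.
by rewrite mulmx_sum_row scaler_sumr; apply: eq_bigr => i _; rewrite mxE.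
Qed.

Lemma kappa_le (d : nat) (Z : lattice_zonotope d) (lam : R) :
  0 <= lam -> lattice_hit (gens Z) lam -> kappa R Z <= lam.
Proof.
move=> lam0 [p [t [ht E]]]; apply: ge_inf; first by exists 0 => x [].
split=> //; exists (p + base Z).
(* Coefficients are rescaled about 1/2. For [lam = 0] the default [0^-1 = 0] gives the center, where
   [t] already is. *)
pose s := const_mx 2^-1 + lam^-1 *: (t - const_mx 2^-1).
exists (real_mx R (base Z) + s *m real_mx R (gens Z)).
  exists s; split=> // i; rewrite !mxE.
  have {}ht := ht i; move: lam0; rewrite le_eqVlt => /orP [/eqP l0|l0].
    by rewrite -l0 invr0 mul0r addr0; lra.
  have : `|lam^-1 * (t 0 i - 2^-1)| <= 2^-1.
    by rewrite normrM gtr0_norm ?invr_gt0 // ler_pdivrMl.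
  by rewrite ler_norml; lra.
rewrite /center half_gens opprD addrACA subrr add0r -mulmxBl scalemxAl -addrA -mulmxDl.
rewrite /real_mx map_mxD addrC -/(real_mx R p) E; congr (_ + _); congr (_ *m _).
rewrite /s [const_mx _ + lam^-1 *: _]addrC addrK scalerA.
have [l0|/divff ->] := eqVneq lam 0; last by rewrite scale1r addrC subrK.
rewrite l0 mul0r scale0r addr0; apply/rowP => i; rewrite mxE.
by have := ht i; rewrite l0 mul0r normr_le0 subr_eq0 => /eqP.
Qed.

(** Strictness yields an admissible factor below [lam] without showing that the infimum is
    attained. *)
Lemma kappa_lt (d : nat) (Z : lattice_zonotope d) (lam : R) :
  kappa R Z < lam -> lattice_hit (gens Z) lam.
Proof.
move=> /inf_lt [|mu [mu0 [p [z [s [hs ->]] E]]] mulam].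
  exists 1; split; first exact: ler01.
  exists (base Z); exists (real_mx R (base Z)); last by rewrite scale1r addrC subrK.
  by exists 0; split=> [i|]; rewrite ?mul0mx ?addr0 // mxE lexx ler01.
apply: lattice_hit_mono (ltW mulam) _.
exists (p - base Z), (const_mx 2^-1 + mu *: (s - const_mx 2^-1)); split.
  move=> i; rewrite !mxE [_ + mu * _]addrC addrK normrM ger0_norm // ler_wpM2l //.
  by have := hs i; rewrite ler_norml; lra.
move: E; rewrite /center half_gens opprD addrACA subrr add0r -mulmxBl scalemxAl -addrA -mulmxDl.
by rewrite real_mxB => ->; rewrite addrAC subrr add0r.
Qed.

Lemma kappa_ge0 (d : nat) (Z : lattice_zonotope d) : 0 <= kappa R Z.
Proof.
rewrite /kappa; set E := [set _ | _].
have [->|/set0P E0] := eqVneq E set0; first by rewrite inf0.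
by apply: lb_le_inf => // x [].
Qed.

Lemma kappa_le1 (d : nat) (Z : lattice_zonotope d) : kappa R Z <= 1.
Proof.
apply: kappa_le ler01 _; exists 0, 0; split=> [i|].
  by rewrite mxE add0r normrN mul1r ger0_norm ?invr_ge0.
by rewrite mul0mx /real_mx map_mx0.
Qed.

Lemma kappaLR_ge0 (k : nat) : 0 <= kappaLR R k.
Proof.
rewrite /kappaLR; set E := [set _ | _ in _].
(* [sup] of the empty set is 0 by default, so no LR zonotope has to be exhibited. *)
have [->|/set0P [x Ex]] := eqVneq E set0; first by rewrite sup0.
have x0 : 0 <= x by case: Ex => Z _ <-; exact: kappa_ge0.
by apply: le_trans x0 _; apply: ub_le_sup => //; exists 1 => y [Z _ <-]; exact: kappa_le1.
Qed.

Lemma kappa_le_kappaLR (k : nat) (Z : lattice_zonotope k) :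
  LR_zonotope Z -> kappa R Z <= kappaLR R k.
Proof.
by move=> LR; apply: ub_le_sup; [exists 1 => y [Y _ <-]; exact: kappa_le1 | exists Z].
Qed.

Lemma bounded_translates (a b M : R) : (forall n : nat, `|a + b *+ n| <= M) -> b = 0.
Proof.
move=> h; apply/eqP; apply: contrapT => /negP b0.
have nb : 0 < `|b| by rewrite normr_gt0.
have := archi_boundP (divr_ge0 (addr_ge0 (le_trans (normr_ge0 _) (h 0)) (normr_ge0 a)) (ltW nb)).
rewrite ltr_pdivrMr // => lt.
set n := Num.bound _ in lt.
have : `|b *+ n| <= M + `|a|.
  by rewrite -[b *+ n](addKr a) addrC; apply: le_trans (ler_normB _ _) _; rewrite lerD2r h.
by rewrite normrMn -mulr_natl leNgt lt.
Qed.

Lemma body_reflect (d : nat) (Z : lattice_zonotope d) (x : 'rV[R]_d) :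
  body Z x -> body Z (2 *: center R Z - x).
Proof.
move=> [t [ht ->]]; exists (const_mx 1 - t); split=> [i|].
  by rewrite !mxE; have := ht i; lra.
have -> : const_mx 1 = 2 *: const_mx 2^-1 :> 'rV[R]_(ngens Z).
  by apply/rowP => i; rewrite !mxE divff ?pnatr_eq0.
by rewrite /center half_gens scalerDr scalemxAl mulmxBl scaler_nat mulr2n opprD addrACA addrK.
Qed.

(** The reflections in the two centers preserve the body and compose to a translation by [2 *: a];
    iterating it stays in a bounded set, so [a] is zero. *)
Lemma eq_center (d : nat) (Z Z' : lattice_zonotope d) :
  body (R := R) Z = body Z' -> center R Z = center R Z'.
Proof.
move=> eqB; apply/rowP => j.
pose a := center R Z' - center R Z.
have shift x : body Z x -> body (R := R) Z (x + 2 *: a).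
  move=> /body_reflect; rewrite eqB => /body_reflect; rewrite -eqB.
  by rewrite opprB addrCA -scalerBr.
have shifts n : body Z (real_mx R (base Z) + (2 *: a) *+ n).
  elim: n => [|n IH]; last by rewrite mulrSr addrA; apply: shift.
  by exists 0; split=> [i|]; rewrite ?mul0mx // mxE lexx ler01.
have /bounded_translates : forall n : nat,
    `|real_mx R (base Z) 0 j + (2 * a 0 j) *+ n| <=
    `|real_mx R (base Z) 0 j| + \sum_i `|real_mx R (gens Z) i j|.
  move=> n; have [t [ht E]] := shifts n.
  have -> : real_mx R (base Z) 0 j + (2 * a 0 j) *+ n =
            (real_mx R (base Z) + (2 *: a) *+ n) 0 j
    by rewrite -mulr_natl -scaler_nat !mxE.
  rewrite E mxE; apply: le_trans (ler_normD _ _) _; rewrite lerD2l mxE.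
  apply: le_trans (ler_norm_sum _ _ _) _; apply: ler_sum => i _.
  by have := ht i; rewrite normrM => /andP [t0 t1]; rewrite ger0_norm // ler_piMl.
move/eqP; rewrite mulf_eq0 pnatr_eq0 /= /a mxE [X in _ + X]mxE subr_eq0.
by move=> /eqP.
Qed.

Lemma eq_kappa (d : nat) (Z Z' : lattice_zonotope d) :
  body (R := R) Z = body Z' -> kappa R Z = kappa R Z'.
Proof. by move=> eqB; rewrite /kappa (eq_center eqB) eqB. Qed.

End LatticeHits.

(** * Reduction to LR zonotopes, and the lower bound 1/3 for [kappaLR] *)

Section Reduction.

(** An injection [f] misses a single row, and a dependence involving that row expresses it through
    the others, so the rank survives its removal. *)
Lemma coloop_free_minor (F : fieldType) (k : nat) (A : 'M[F]_(k.+1, k)) :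
  \rank A = k -> coloop_free A ->
  forall f : 'I_k -> 'I_k.+1, injective f -> \det (rowsub f A) != 0.
Proof.
move=> rk free f injf.
have AB : (A <= rowsub f A)%MS.
  apply/row_subP => m; have [/codomP [l ->]|mf] := boolP (m \in codom f).
    by rewrite -row_rowsub row_sub.
  have inf l : l != m -> l \in codom f.
    move=> lm; apply: contraT => lf.
    have sub : codom f \subset ([set~ m] :\ l)%SET.
      apply/fintype.subsetP => z zf; rewrite !inE.
      by apply/andP; split; apply: contraTneq zf => ->.
    have := subset_leq_card sub; rewrite card_codom // card_ord.
    have := cardsD1 l [set~ m]%SET; rewrite cardsC1 card_ord !inE lm; lia.
  have [x xA xm] := free m.
  have : \sum_l x 0 l *: row l A = 0 by rewrite -mulmx_sum_row.
  rewrite (bigD1 m) //= => /eqP; rewrite addr_eq0 => /eqP E.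
  rewrite -(scalerK xm (row m A)) E; apply: scalemx_sub; rewrite eqmx_opp.
  apply: summx_sub => l /inf /codomP [l' ->]; apply: scalemx_sub.
  by rewrite -row_rowsub row_sub.
have : row_full (rowsub f A) by rewrite -col_leq_rank -{1}rk mxrankS.
by rewrite row_full_unit unitmxE unitfE.
Qed.

Variable R : realType.

Lemma real_merge (n d : nat) (j : 'I_n.+1) (i : 'I_n) (e : bool) (U : 'M[int]_(n.+1, d)) :
  real_mx R (merge_mx int j i e *m U) = merge_mx R j i e *m real_mx R U.
Proof. by rewrite real_mxM /real_mx map_merge_mx. Qed.

(** Distinct rows give an LR zonotope. Two equal rows would make a minor containing both vanish,
    except in dimension 1, where two equal generators have their half-sum, the center, in the
    lattice. *)
Lemma coloop_free_lattice_hit1 (k : nat) (U : 'M[int]_(k.+2, k.+1)) (delta : R) :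
  0 < delta -> \rank (real_mx R U) = k.+1 -> coloop_free (real_mx R U) ->
  lattice_hit U (kappaLR R k.+1 + delta).
Proof.
move=> d0 rk free.
have minors (f : 'I_k.+1 -> 'I_k.+2) : injective f -> \det (rowsub f U) != 0.
  move=> /(coloop_free_minor rk free); rewrite -(intr_eq0 R) -det_map_mx.
  by congr (\det _ != 0); apply/matrixP => a b; rewrite !mxE.
have [inj|ninj] := pselect (injective (fun i => row i U)).
  apply: (@kappa_lt R _ (LatticeZonotope 0 inj)).
  by rewrite ltr_pwDr // kappa_le_kappaLR //; split.
have [i [j [ij rij]]] : exists i j, i != j /\ row i U = row j U.
  apply: contrapT => /forallNP h; apply: ninj => i j rij.
  by apply: contrapT => /eqP ij; apply: (h i); exists j.
have k0 : k = 0%N.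
  apply/eqP; rewrite -leqn0 leqNgt; apply/negP => kpos.
  have [l li lj] : exists2 l : 'I_k.+2, l != i & l != j.
    have : (0 < #|[set~ i] :\ j|)%N.
      have := cardsD1 j [set~ i]%SET; rewrite cardsC1 card_ord !inE eq_sym ij; lia.
    by case/card_gt0P => l; rewrite !inE => /andP [lj li]; exists l.
  have [i' hi _] := unlift_some li; have [j' hj _] := unlift_some lj.
  have ij' : i' != j' by apply: contraNneq ij => e; rewrite hi hj e.
  have /eqP := minors (lift l) lift_inj; apply.
  apply: (determinant_alternate ij') => c; rewrite !mxE -hi -hj.
  by have /rowP /(_ c) := rij; rewrite !mxE.
subst k; apply: (@lattice_hit_mono _ _ _ _ 0); first by rewrite addr_ge0 ?kappaLR_ge0 ?ltW.
exists (row i U), (const_mx 2^-1); split=> [l|].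
  by rewrite mxE subrr normr0 mul0r.
apply/rowP => c; rewrite -half_gens (bigD1 i) //= (bigD1 j) 1?eq_sym //= big1 ?addr0.
  have := congr1 (fun v : 'rV[int]_1 => (v 0 c)%:~R : R) rij; rewrite !mxE => ->; lra.
move=> l /andP [li lj]; exfalso; move: ij li lj.
by case: i {rij} => [[|[|?]] ?] //; case: j => [[|[|?]] ?] //; case: l => [[|[|?]] ?].
Qed.

(** Generators are merged until [k.+2] remain. With only [k.+1] the rows would be independent and
    admit no nonzero dependence. *)
Lemma coloop_free_lattice_hit (n k : nat) (U : 'M[int]_(n, k.+1)) (delta : R) :
  0 < delta -> \rank (real_mx R U) = k.+1 -> coloop_free (real_mx R U) ->
  lattice_hit U (kappaLR R k.+1 + delta).
Proof.
move=> d0; elim: n U => [|n IH] U rk free.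
  by have := rank_leq_row (real_mx R U); rewrite rk.
have [kn|nk] := ltnP k.+1 n.
  have [j [i [e]]] := exists_merge kn rk free; rewrite -real_merge => -[rk' free'].
  exact: lattice_hit_merge (IH _ rk' free').
have [nE|nk'] := eqVneq n k.+1; first by subst n; exact: coloop_free_lattice_hit1.
have rf : row_free (real_mx R U) by rewrite -row_leq_rank rk; lia.
have [x xU] := free ord0.
by rewrite (row_free_inj rf (etrans xU (esym (mul0mx _ _)))) mxE eqxx.
Qed.

(** Take the unit vectors and [(2, ..., 2)]: each coordinate has center 3/2 and half-width 3/2, so
    reaching the integer 1 or 2 needs a factor 1/3. *)
Lemma kappaLR_ge3V (k : nat) : 3^-1 <= kappaLR R k.+1.
Proof.
apply/ler_addgt0Pr => delta d0.
pose U : 'M[int]_(k.+1 + 1, k.+1) := col_mx 1%:M (const_mx 2).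
have UE : real_mx R U = col_mx 1%:M (const_mx 2).
  by rewrite /real_mx map_col_mx map_mx1 map_const_mx.
have rk : \rank (real_mx R U) = k.+1.
  apply/eqP; rewrite eqn_leq rank_leq_col /= -{1}(mxrank1 R k.+1) mxrankS //.
  by rewrite UE -addsmxE addsmxSl.
have free : coloop_free (real_mx R U).
  move=> i; exists (row_mx (const_mx 2) (const_mx (- 1))).
    rewrite UE mul_row_col mulmx1; apply/rowP => c.
    by rewrite !mxE big_ord1 !mxE mulN1r subrr.
  rewrite -(fintype.splitK i) /unsplit; case: (fintype.split i) => l.
    by rewrite row_mxEl mxE pnatr_eq0.
  by rewrite row_mxEr mxE oppr_eq0 oner_eq0.
have [p [t [ht]]] := coloop_free_lattice_hit d0 rk free.
rewrite UE -[t]hsubmxK mul_row_col mulmx1 => /rowP /(_ 0).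
rewrite !mxE big_ord1 !mxE.
have := ht (lshift 1 0); have := ht (rshift k.+1 0).
set a := t 0 _; set b := t 0 _; set q := p 0 0; set lam := kappaLR R k.+1 + delta.
rewrite !ler_norml => /andP [b1 b2] /andP [a1 a2] E.
have [q1|q2] : (q <= 1) \/ (2 <= q) by lia.
  have : q%:~R <= 1 :> R by rewrite -[1]/(1%:~R) ler_int.
  lra.
have : 2 <= q%:~R :> R by rewrite -[2]/(2%:~R) ler_int.
lra.
Qed.

End Reduction.

(** * Projection along a lattice vector *)

Section Projection.

(** Smith normal form of a single row. In the new basis, projecting along [v] means dropping the
    first coordinate. *)
Lemma straighten (d : nat) (v : 'rV[int]_d.+1) :
  exists2 P : 'M[int]_d.+1, P \in unitmx & exists g : int, v *m P = g *: delta_mx 0 ord0.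
Proof.
have [L _ [P uP [s _ ->]]] := int_Smith_normal_form v.
exists (invmx P); first by rewrite unitmx_inv.
exists (L 0 0 * s`_0); rewrite mulmxK //; apply/rowP => j.
by rewrite mxE big_ord1 !mxE eqxx /= eq_sym -mulrA mulr_natr.
Qed.

Variable R : realType.

Lemma real_unitmx (d : nat) (P : 'M[int]_d) : P \in unitmx -> real_mx R P \in unitmx.
Proof. by rewrite !unitmxE det_map_mx; exact: rmorph_unit. Qed.

Lemma mulmx_col' (F : pzRingType) (m n p : nat) (j : 'I_p.+1) (A : 'M[F]_(m, n))
    (B : 'M[F]_(n, p.+1)) : A *m col' j B = col' j (A *m B).
Proof. by apply/matrixP => a b; rewrite !mxE; apply: eq_bigr => c _; rewrite mxE. Qed.

Lemma rank_col' (F : fieldType) (n k : nat) (A : 'M[F]_(n, k.+1)) (j : 'I_k.+1) :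
  \rank A = k.+1 -> \rank (col' j A) = k.
Proof.
move=> rk; have /row_fullP [B BA] : row_full A by rewrite /row_full rk.
apply/eqP; rewrite -/(row_full _); apply/row_fullP; exists (row' j B).
rewrite mulmx_col'; apply/matrixP => a b; rewrite mxE.
have /matrixP /(_ (lift j a) (lift j b)) := BA; rewrite !mxE (inj_eq lift_inj) => <-.
by apply: eq_bigr => c _; rewrite mxE.
Qed.

Lemma add_scaled_delta (F : pzRingType) (n : nat) (x : 'rV[F]_n) (i : 'I_n) (a b : F) :
  (x + a *: (b *: delta_mx 0 i)) 0 i = x 0 i + a * b.
Proof. by rewrite !mxE !eqxx mulr1. Qed.

(* The projection along v takes care of all coordinates but one, and r moves the
   remaining coordinate by l times a nonzero integer. *)
Lemma projection_hit (k n l : nat) (U : 'M[int]_(n, k.+2)) (r : 'rV[R]_n)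
    (v : 'rV[int]_k.+2) (delta : R) :
  (0 < l)%N -> 0 < delta -> \rank (real_mx R U) = k.+2 -> coloop_free (real_mx R U) ->
  (forall i, `|r 0 i| <= 1) -> r *m real_mx R U = l%:R *: real_mx R v -> v != 0 ->
  lattice_hit U (kappaLR R k.+1 + l%:R^-1 + delta).
Proof.
move=> l0 d0 rk free hr rU v0.
have [P uP [g vP]] := straighten v.
have uPR := real_unitmx uP.
have g0 : g != 0.
  apply: contraNneq v0 => g0; apply/eqP; rewrite -(mulmxK uP v) vP g0 scale0r.
  by rewrite mul0mx.
apply: (lattice_hit_basis uP).
have colE : real_mx R (col' ord0 (U *m P)) = col' ord0 (real_mx R U *m real_mx R P).
  by rewrite -real_mxM; apply/matrixP => a b; rewrite !mxE.
have rk' : \rank (real_mx R (col' ord0 (U *m P))) = k.+1.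
  by rewrite colE rank_col' // mxrankMfree ?row_free_unit.
have free' : coloop_free (real_mx R (col' ord0 (U *m P))).
  move=> i; have [x xU xi] := free i; exists x => //.
  by rewrite colE mulmx_col' mulmxA xU mul0mx; apply/matrixP => a b; rewrite !mxE.
have [p [t [ht E]]] := coloop_free_lattice_hit d0 rk' free'.
set A := real_mx R U *m real_mx R P in colE.
pose x0 := (t *m A) 0 ord0.
have [m hm] : exists m : int, `|m%:~R - x0| <= 2^-1.
  exists (Num.floor (x0 + 2^-1)); have := floor_itv (x0 + 2^-1).
  by rewrite intrD ler_norml => /andP [h1 h2]; apply/andP; split; lra.
have l0R : 0 < l%:R :> R by rewrite ltr0n.
have g0R : g%:~R != 0 :> R by rewrite intr_eq0.
(* Adding [sigma *: r] to [t] moves only the first coordinate, from [x0] to the nearby integer [m].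
   As this distance is at most 1/2 and [g] is a nonzero integer, the cost in [lam] is at most
   [1/l]. *)
pose sigma := (m%:~R - x0) / (l%:R * g%:~R).
have hsigma : `|sigma| <= l%:R^-1 / 2.
  have g1 : 1 <= `|g%:~R| :> R by rewrite -intr_norm -[1]/(1%:~R) ler_int; lia.
  rewrite /sigma normrM normfV normrM (gtr0_norm l0R) ler_pdivrMr; last first.
    by rewrite mulr_gt0 // normr_gt0.
  rewrite mulrACA mulVf ?gt_eqF // mul1r; lra.
exists (\row_j if unlift ord0 j is Some j' then p 0 j' else m), (t + sigma *: r); split.
  move=> i; rewrite !mxE addrAC; apply: le_trans (ler_normD _ _) _.
  have := ht i; have : `|sigma * r 0 i| <= `|sigma| by rewrite normrM ler_piMr.
  lra.
have -> : real_mx R (U *m P) = A by rewrite real_mxM.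
have rA : r *m A = (l%:R * g%:~R) *: delta_mx 0 ord0.
  rewrite /A mulmxA rU -scalemxAl -real_mxM vP -scalerA; congr (_ *: _).
  by apply/rowP => j; rewrite !mxE intrM; case: (_ && _).
rewrite mulmxDl -scalemxAl rA.
apply/rowP => j; rewrite mxE [in LHS]mxE; case: (unliftP ord0 j) => [j' ->|->].
  have /rowP /(_ j') := E; rewrite colE mulmx_col' !mxE => ->.
  by rewrite mulr0 mulr0 addr0.
rewrite add_scaled_delta -/x0 /sigma divfK; first by rewrite addrC subrK.
by apply: mulf_neq0 => //; rewrite gt_eqF.
Qed.

End Projection.

(** * Residue classes of lattice points *)

Section Residues.

Definition residue (d l : nat) (p : 'rV[int]_d) : {ffun 'I_d -> 'I_l.+1} :=
  [ffun j => inord `|(p 0%R j %% l.+1%:Z)%Z|%N].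

Lemma residueP (d l : nat) (p q : 'rV[int]_d) :
  residue l p = residue l q -> exists v, p = q + l.+1%:Z *: v.
Proof.
move=> /ffunP E; exists (\row_j ((p 0%R j %/ l.+1%:Z)%Z - (q 0%R j %/ l.+1%:Z)%Z)).
apply/rowP => j; rewrite !mxE; have := E j; rewrite !ffunE => /(congr1 val) /=.
have h (z : int) : (`|(z %% l.+1%:Z)%Z|%N < l.+1)%N by have := ltz_pmod z (isT : 0 < l.+1%:Z); lia.
rewrite !inordK // => e.
have {e} : (p 0%R j %% l.+1%:Z)%Z = (q 0%R j %% l.+1%:Z)%Z.
  have := modz_ge0 (p 0 j) (isT : l.+1%:Z != 0).
  by have := modz_ge0 (q 0 j) (isT : l.+1%:Z != 0); lia.
by rewrite {2}(divz_eq (p 0 j) l.+1%:Z) {2}(divz_eq (q 0 j) l.+1%:Z) => ->; ring.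
Qed.

Lemma card_residues (d l : nat) : #|{ffun 'I_d -> 'I_l.+1}| = (l.+1 ^ d)%N.
Proof. by rewrite card_ffun !card_ord. Qed.

Variable R : realType.

(** The class is chosen so that the new coefficients are [(s 0 i + l./2) / l] with [s 0 i] in
    [0, 1], hence within [1/l] of 1/2 for either parity of [l]. *)
Lemma residues_hit (d l : nat) (Z : lattice_zonotope d) : (0 < l)%N ->
  (forall w : 'rV[int]_d, exists v, lattice_points R Z (w + l%:Z *: v)) ->
  lattice_hit (gens Z) (2 / l%:R : R).
Proof.
move=> l0 hZ; have l0R : 0 < l%:R :> R by rewrite ltr0n.
have [x [s [hs E]]] := hZ (base Z - (l./2)%:Z *: (const_mx 1 *m gens Z)).
exists x, (l%:R^-1 *: (s + const_mx (l./2)%:R)); split=> [i|].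
  rewrite !mxE -(ler_pM2l l0R) -[leLHS](congr1 (fun y => y * _) (gtr0_norm l0R)) -normrM.
  rewrite mulrBr mulVKf ?gt_eqF // mulrA mulrCA divff ?gt_eqF // mulr1 divff ?pnatr_eq0 //.
  have lE : l%:R = (odd l)%:R + 2 * (l./2)%:R :> R.
    by rewrite -[in LHS](odd_double_half l) natrD -mul2n natrM.
  have := hs i; rewrite lE ler_norml; case: (odd l) => /= ?; lra.
rewrite -scalemxAl mulmxDl.
have -> : s *m real_mx R (gens Z) =
    l%:R *: real_mx R x - (l./2)%:R *: (const_mx 1 *m real_mx R (gens Z)).
  apply: (addrI (real_mx R (base Z))); rewrite -E.
  have -> : const_mx 1 *m real_mx R (gens Z) = real_mx R (const_mx 1 *m gens Z).
    by move=> m; rewrite real_mxM {2}/real_mx map_const_mx.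
  by apply/rowP => j; rewrite !mxE !(intrD, intrN, intrM) /=; ring.
have -> : const_mx (l./2)%:R = (l./2)%:R *: const_mx 1 :> 'rV[R]_(ngens Z).
  by apply/rowP => j; rewrite !mxE mulr1.
by rewrite -scalemxAl subrK scalerA mulVf ?gt_eqF // scale1r.
Qed.

Lemma mul_indicator (F : pzRingType) (n d : nat) (S : {set 'I_n}) (A : 'M[F]_(n, d)) :
  (\row_l (l \in S)%:R) *m A = \sum_(l in S) row l A.
Proof.
rewrite mulmx_sum_row [RHS]big_mkcond; apply: eq_bigr => l _; rewrite mxE.
by case: (l \in S); rewrite ?scale1r ?scale0r.
Qed.

(** If all rows outside the basis were zero, every dependence would restrict to one of the basis and
    vanish there, making [f ord0] a coloop. *)
Lemma coloop_free_extra_row (F : fieldType) (n d : nat) (A : 'M[F]_(n, d.+1))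
    (f : 'I_d.+1 -> 'I_n) : injective f -> rowsub f A \in unitmx -> coloop_free A ->
  exists2 m, m \notin codom f & row m A != 0.
Proof.
move=> injf uB free; apply: contrapT => none.
have row0 m : m \notin codom f -> row m A = 0.
  by move=> mf; apply: contrapT => /eqP nz; apply: none; exists m.
have [x xA /eqP x0] := free (f ord0); apply: x0.
suff : colsub f x = 0 by move/rowP/(_ ord0); rewrite !mxE.
apply: (row_free_inj (A := rowsub f A)); first by rewrite row_free_unit.
rewrite mul0mx -xA [RHS]mulmx_sum_row (bigID [in codom f]) /= [X in _ + X]big1 ?addr0.
  rewrite mulmx_sum_row.
  rewrite (eq_bigl [in f @: [set i | true]%SET]) ?big_imset /=.
  - by apply: eq_big => [i|i _]; rewrite ?inE // mxE row_rowsub.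
  - by move=> a b _ _; apply: injf.
  - by move=> l; apply/codomP/imsetP => [[i ->]|[i _ ->]]; exists i; rewrite ?inE.
by move=> l /row0 ->; rewrite scaler0.
Qed.

(** The subset sums of a basis and one further point outnumber the classes modulo 2. *)
Lemma coloop_free_even_difference (d : nat) (Z : lattice_zonotope d.+1) :
  zdim R Z = d.+1 -> coloop_free (real_mx R (gens Z)) ->
  exists p q v, [/\ lattice_points R Z p, lattice_points R Z q,
    p != q & p = q + 2 *: v].
Proof.
move=> rk free; set A := real_mx R (gens Z) in free.
have full : row_full A by rewrite /row_full; apply/eqP.
pose f := fullrankfun full.
have injf : injective f := @fullrankfun_inj _ _ _ _ full.
pose B := rowsub f A.
have uB : B \in unitmx by rewrite -row_full_unit; exact: fullrowsub_full full.
have [m mf mA] := coloop_free_extra_row injf uB free.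
pose a := row m A *m invmx B.
have [j aj] : exists j, a 0 j != 0.
  apply: contrapT => /forallNP h; move/negP: mA; apply; rewrite -(mulmxKV uB (row m A)) -/a.
  have -> : a = 0 
    by apply/rowP => i; rewrite [RHS]mxE; apply/eqP/negPn/negP; exact: h.
  by rewrite mul0mx.
(* [None] is the further point. Its [j]-th coordinate in the basis is [a 0 j + 1 > 1] or
   [a 0 j < 0], while subset sums have coordinates 0 and 1. *)
pose S (o : option {set 'I_d.+1}) : {set 'I_(ngens Z)} :=
  if o is Some J then (f @: J)%SET else (if 0 < a 0 j then [set m; f j] else [set m])%SET.
pose tau (o : option {set 'I_d.+1}) : 'rV[int]_(ngens Z) := \row_l (l \in S o)%:R.
have tauE o : real_mx R (tau o) = \row_l (l \in S o)%:R.
  by apply/rowP => l; rewrite !mxE; case: (_ \in _).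
pose h o := base Z + tau o *m gens Z.
have hZ o : lattice_points R Z (h o).
  exists (real_mx R (tau o)); rewrite /h real_mxD real_mxM; split=> // l.
  by rewrite tauE mxE; case: (_ \in _); rewrite ?lexx ?ler01.
pose c o := real_mx R (tau o) *m A *m invmx B.
have rowB i : row (f i) A *m invmx B = delta_mx 0 i.
  by rewrite -row_rowsub -row_mul mulmxV // row1.
have cS I i : c (Some I) 0 i = (i \in I)%:R.
  rewrite /c tauE mul_indicator big_imset /=; last by move=> x y _ _; apply: injf.
  rewrite mulmx_suml summxE (eq_bigr (fun l => (i == l)%:R)); last first.
    by move=> l _; rewrite rowB mxE.
  rewrite big_mkcond (bigD1 i) //= eqxx big1 ?addr0; first by case: (i \in I).
  by move=> l li; rewrite eq_sym (negbTE li); case: (l \in I).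
have cN : c None 0 j = a 0 j + (0 < a 0 j)%R%:R.
  rewrite /c tauE mul_indicator /S; case: ifP => _.
    rewrite big_setU1 ?big_set1 /=; first by rewrite mulmxDl rowB mxE -/a !mxE !eqxx.
    by rewrite inE; apply: contraNneq mf => ->; exact: codom_f.
  by rewrite big_set1 -/a addr0.
have ch o o' : h o = h o' -> c o = c o'.
  by move=> /addrI /(congr1 (@real_mx R _ _)); rewrite !real_mxM /c => ->.
have SN I : c (Some I) <> c None.
  move=> /rowP /(_ j); rewrite cS cN; case: ltrgtP aj => // aj _ /eqP; rewrite eq_sym; apply/negP.
    by apply/eqP; case: (j \in I) => /=; lra.
  by apply/eqP; case: (j \in I) => /=; lra.
have injh : injective h.
  move=> [I|] [I'|] /ch // E; last first.
  - by case: (SN I').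
  - by case: (SN I).
  congr Some; apply/setP => i; have /rowP /(_ i) /eqP := E.
  by rewrite !cS eqr_nat; do 2![case: (i \in _)].
have ninj : ~ injective (fun o => residue 1 (h o)).
  move=> /leq_card; rewrite card_residues card_option -cardsT -powersetT card_powerset.
  by rewrite cardsT card_ord ltnn.
have [o [o' [oo' E]]] : exists o o', o != o' /\ residue 1 (h o) = residue 1 (h o').
  apply: contrapT => /forallNP no; apply: ninj => o o' E.
  by apply: contrapT => /eqP oo'; apply: (no o); exists o'.
have [v hv] := residueP E.
by exists (h o), (h o'), v; split; rewrite ?(inj_eq injh).
Qed.

End Residues.

(** * The bound from congruent points, and the case distinction on residues *)

(** The difference of the coefficient vectors of [p] and [q] has entries in [-1, 1] and maps to [l]
    times [v], as the projection argument requires. *)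
Lemma congruent_points_kappa (R : realType) (k l : nat) (Z : lattice_zonotope k.+2)
    (p q v : 'rV[int]_k.+2) :
  (0 < l)%N -> zdim R Z = k.+2 -> coloop_free (real_mx R (gens Z)) ->
  lattice_points R Z p -> lattice_points R Z q -> p != q -> p = q + l%:Z *: v ->
  kappa R Z <= kappaLR R k.+1 + l%:R^-1.
Proof.
move=> l0 rk free [t [ht pE]] [s [hs qE]] pq pqv.
apply/ler_addgt0Pr => delta d0; apply: kappa_le.
  by rewrite !addr_ge0 ?kappaLR_ge0 ?invr_ge0 ?ler0n ?(ltW d0).
apply: (projection_hit (r := t - s) (v := v)) => //.
- by move=> i; have := ht i; have := hs i; rewrite !mxE ler_norml; lra.
- have := real_mxB R p q; rewrite pE qE opprD addrACA subrr add0r -mulmxBl => <-.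
  by rewrite pqv addrC addKr; apply/rowP => j; rewrite !mxE intrM.
- by apply: contraNneq pq => v0; rewrite pqv v0 scaler0 addr0.
Qed.

Lemma card_le_injection (T : Type) (B : set T) (n : nat) : (`I_n #<= B)%card ->
  exists2 h : 'I_n -> T, injective h & forall i, B (h i).
Proof.
move=> /card_leP [f].
have mem (i : 'I_n) : (i : nat) \in `I_n by rewrite inE /=; exact: ltn_ord.
exists (fun i => set_val (f (SigSub (mem i)))).
  move=> i j /val_inj /inj; rewrite !inE => /(_ Logic.I Logic.I) /(congr1 val) /=.
  exact: val_inj.
by move=> i; exact: set_mem (valP _).
Qed.

Theorem theorem3p8 (R : realType) (d l : nat) (Z : lattice_zonotope d)
    (hd : (2 <= d)%N) (hl : (0 < l)%N)
    (hdim : zdim R Z = d) (hcol : coloopless R Z)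
    (hpts : (`I_(l ^ d) #<= lattice_points R Z)%card) :
  kappa R Z <= kappaLR R d.-1 + l%:R^-1.
Proof.
case: d hd Z hdim hcol hpts => [|[|k]] // _ Z0 _ [Z [eqB rk [lam [lam0 lamZ]]]].
(* [kappa] and the lattice points depend only on the body, so the presentation carrying the
   dependence replaces the given one. *)
rewrite -(eq_kappa eqB) /lattice_points -eqB -/(lattice_points R Z) /=.
move=> /card_le_injection [h injh hZ].
have free : coloop_free (real_mx R (gens Z)) by move=> i; exists lam.
case: l hl h injh hZ => [//|l] _ h injh hZ.
have [injr|ninj] := pselect (injective (fun i => residue l (h i))); last first.
  have [i [j [ij E]]] : exists i j, i != j /\ residue l (h i) = residue l (h j).
    apply: contrapT => /forallNP no; apply: ninj => i j E.
    by apply: contrapT => /eqP ij; apply: (no i); exists j.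
  have [v hv] := residueP E.
  by apply: congruent_points_kappa (hZ i) (hZ j) _ hv; rewrite ?(inj_eq injh).
(* The modulus is now [l.+1], so this is the case of modulus 2. *)
have [l2|l2] := eqVneq l 1%N.
  have [p [q [v [hp hq pq pqv]]]] := coloop_free_even_difference rk free.
  by apply: congruent_points_kappa hp hq pq _ => //; rewrite l2; exact: pqv.
have [->|l0] := eqVneq l 0%N.
  by apply: le_trans (kappa_le1 R Z) _; rewrite invr1 lerDr kappaLR_ge0.
(* An injection between finite sets of equal size is onto, so every class is represented. *)
have surj w : exists v, lattice_points R Z (w + l.+1%:Z *: v).
  have := inj_card_onto injr; rewrite card_residues card_ord leqnn.
  by move=> /(_ isT (residue l w)) /codomP [i /esym /residueP [v hv]]; exists v; rewrite -hv.
have l0R : 0 < l.+1%:R :> R by rewrite ltr0n.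
apply: (le_trans (kappa_le _ (residues_hit (ltn0Sn l) surj))).
  by rewrite divr_ge0 // ltW.
(* One of the two summands [1/l.+1] is kept; the other is at most 1/3, as [l.+1] is at least 3. *)
rewrite mulrDl mul1r lerD2r; apply: le_trans (kappaLR_ge3V R k).
by rewrite lef_pV2 ?posrE ?ltr0n // ler_nat; lia.
Qed.
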